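(* If $X$ is a regular space and $F(X)=\omega$, then $t(X_\delta)\le 2^\omega$.
   Context: Regular spaces are assumed to be $T_1$. For a space $X$, $X_\delta$ (the $G_\delta$-modification of $X$) is the set $X$ with the topology generated by the $G_\delta$-subsets of $X$ (the $G_\delta$-subsets of $X$ form a base). The tightness $t(Z)$ of a space $Z$ is the least infinite cardinal $\lambda$ such that whenever $A \subseteq Z$ and $p \in \overline{A}$ there is $B \subseteq A$ with $|B| \leq \lambda$ and $p \in \overline{B}$. A set $\{x_\alpha: \alpha <\kappa \}\subseteq X$ is a free sequence if $\overline{\{x_\beta:\beta<\alpha \}}\cap \overline{\{x_\beta:\alpha \le \beta<\kappa \}}=\emptyset$ for each $\alpha <\kappa$. $F(X)$ is the supremum of the cardinalities of free sequences in $X$; as usual for cardinal functions, values are taken to be infinite, so $F(X)=\omega$ means that $X$ has no uncountable free sequence. *)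

(* Defs.v *)
From HB Require Import structures.
From mathcomp Require Import all_boot all_order.
From mathcomp Require Import all_classical topology.
From mathcomp Require Import wochoice borel_hierarchy.

Set Implicit Arguments.
Unset Strict Implicit.
Unset Printing Implicit Defensive.

Local Open Scope classical_set_scope.
Local Open Scope card_scope.

Definition Gdelta_modification (X : Type) : Type := X.

Section Gdelta_modification_topology.
Variable X : topologicalType.

Let Gdelta_cover : \bigcup_(A in @Gdelta X) A = setT.
Proof.
apply/seteqP; split=> // x _; exists setT => //.
exact/open_Gdelta/openT.
Qed.

Let Gdelta_join (A B : set X) (x : X) : Gdelta A -> Gdelta B -> A x -> B x ->
  exists C : set X, [/\ Gdelta C, C x & C `<=` A `&` B].
Proof.
move=> [F oF ->] [G oG ->] Fx Gx; exists (\bigcap_i (F i `&` G i)); split.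
- by exists (fun i => F i `&` G i) => // i; exact: openI.
- by move=> i _; split; [exact: Fx|exact: Gx].
- by move=> y FGy; split=> i _; have [] := FGy i I.
Qed.

HB.instance Definition _ := Choice.on (Gdelta_modification X).
HB.instance Definition _ := isBaseTopological.Build (Gdelta_modification X)
  Gdelta_cover Gdelta_join.

End Gdelta_modification_topology.

(* Cardinals are represented by sets taken up to equipotence, so a cardinal
   function is a relation between spaces and sets: [P V L] reads "the cardinal
   |L| has property P", and K is the least infinite cardinal with P. *)
Definition least_infinite_cardinal
    (P : forall V : Type, set V -> Prop) (U : Type) (K : set U) : Prop :=
  [/\ infinite_set K, P U K &
      forall (V : Type) (L : set V), infinite_set L -> P V L -> K #<= L].

(* t(Z) = |K| *)
Definition tightness_is (Z : topologicalType) (U : Type) (K : set U) : Prop :=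
  least_infinite_cardinal
    (fun V (L : set V) => forall (A : set Z) (p : Z), closure A p ->
       exists B : set Z, [/\ B `<=` A, B #<= L & closure B p])
    K.

(* The index set {alpha < kappa} is an arbitrary well-ordered type (I, le);
   as le is total, [~~ le a b] means b < a. *)
Definition free_sequence (X : topologicalType) (I : Type) (le : rel I)
    (x : I -> X) : Prop :=
  well_order le /\
  forall a : I, closure [set x b | b in [set b | ~~ le a b]] `&`
                closure [set x b | b in [set b | le a b]] = set0.

(* F(X) = |K|: a supremum whose value is taken to be infinite is the least
   infinite upper bound. *)
Definition free_sequence_number_is (X : topologicalType) (U : Type)
    (K : set U) : Prop :=
  least_infinite_cardinal
    (fun V (L : set V) => forall (I : Type) (le : rel I) (x : I -> X),
       free_sequence le x -> range x #<= L)
    K.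

(* Main.v *)
(* For each set C whose closure misses p, regularity gives an open neighborhood
   U(C) of p with closure disjoint from that of C. Close a subset B of A, of
   size at most continuum, under picking a point of A in each countable
   intersection of sets U(C) with C a countable subset of B; such points exist
   since p is in the G_delta-closure of A. Let G be the intersection of open
   sets G_n containing p, and suppose that G misses B. As p is not in the
   closure of B \ G_n, the absence of uncountable free sequences yields
   countably many countable subsets C of B \ G_n such that the sets U(C) have
   no common point in B \ G_n. Collecting these C for all n, the point of B
   picked for them lies in no B \ G_n, hence in G. *)
Require Import Defs.
From HB Require Import structures.
From mathcomp Require Import all_boot all_order.
From mathcomp Require Import all_classical topology.
From mathcomp Require Import wochoice borel_hierarchy.

Set Implicit Arguments.
Unset Strict Implicit.
Unset Printing Implicit Defensive.

Local Open Scope classical_set_scope.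
Local Open Scope card_scope.

(** * Comparison and minima of cardinals *)

Lemma set_inj_card_le (T U : Type) (A : set T) (B : set U) (f : T -> U) :
  set_fun A B f -> set_inj A f -> A #<= B.
Proof.
move=> fAB finj.
have /injfunPex[g] : exists2 g : T -> U, set_fun A B g & set_inj A g.
  by exists f.
exact: inj_card_le g.
Qed.

(* A maximal set of choice functions with injective projections projects onto
   one of the factors. *)
Lemma card_family_min (I : Type) (T : I -> Type) (F : forall i, set (T i)) :
  I -> exists i, forall j, F i #<= F j.
Proof.
move=> i0.
pose P := [set S : set (forall i, T i) | (forall g i, S g -> F i (g i)) /\
  forall i g h, S g -> S h -> g i = h i -> g = h].
have [|S [[SF Sinj] Smax]] := @Zorn_bigcup _ P.
  move=> C CP Ctot; split=> [g i [S CS Sg]|i g h [S CS Sg] [S' CS' S'h] gh].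
    exact: (CP _ CS).1.
  have [SS'|S'S] := Ctot _ _ CS CS'.
    exact: (CP _ CS').2 (SS' _ Sg) S'h gh.
  exact: (CP _ CS).2 Sg (S'S _ S'h) gh.
(* If every projection of [S] missed a point of its factor, choosing one missed point in each factor
   would give a function extending [S], against maximality. *)
have [i Fi] : exists i, F i `<=` [set g i | g in S].
  apply: contrapT => /forallNP noi.
  have new i : exists t, F i t /\ ~ [set g i | g in S] t.
    by have /existsNP[t /not_implyP tP] := noi i; exists t.
  pose g i := sval (cid (new i)).
  have Fg i : F i (g i) by rewrite /g; case: cid => t [].
  have gS h i : S h -> h i <> g i.
    by rewrite /g; case: cid => t [_ tS] /= Sh ht; apply: tS; exists h.
  apply: (Smax (S `|` [set g])); last first.
    split=> [h i [/SF//|->//]|i h k].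
    move=> [Sh|->] [Sk|->]; [exact: Sinj|by move/(gS _ _ Sh)| |by []].
    by move/esym/(gS _ _ Sk).
  split=> [h Sh|Sg]; first by left.
  by have /gS-/(_ i0) := Sg g (or_intror erefl).
exists i => j; apply: card_le_trans (subset_card_le Fi) _.
apply: card_le_trans (card_image_le _ _) _.
apply: (@set_inj_card_le _ _ _ _ (fun g => g j)) => [g /SF//|].
by move=> g h /set_mem Sg /set_mem Sh; exact: Sinj.
Qed.

Lemma card_le_total (T U : Type) (A : set T) (B : set U) :
  A #<= B \/ B #<= A.
Proof.
pose TU b := if b then T else U.
pose F b : set (TU b) := if b is true then A else B.
have [[] Fmin] := @card_family_min bool TU F true.
  by left; exact: Fmin false.
by right; exact: Fmin true.
Qed.

(** The minimum is sought among subsets of [W] only: a competitor [L] in another type either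
    dominates [D] or injects into it, and is then replaced by its image in [W]. *)
Lemma least_infinite_cardinal_exists (P : forall V : Type, set V -> Prop)
    (W : pointedType) (D : set W) :
  (forall V V' (L : set V) (L' : set V'), L #<= L' -> P V L -> P V' L') ->
  infinite_set D -> P W D ->
  exists K : set W, least_infinite_cardinal P K /\ K #<= D.
Proof.
move=> Pmono Dinf PD.
pose I := {K : set W | infinite_set K /\ P W K}.
have [[K [Kinf PK]] Kmin] :=
  @card_family_min I (fun=> W) (fun i => sval i) (exist _ D (conj Dinf PD)).
have KD : K #<= D := Kmin (exist _ D (conj Dinf PD)).
exists K; split=> //; split=> // V L Linf PL.
have [DL|/pcard_leP[f]] := card_le_total D L; first exact: card_le_trans KD DL.
have LfL : L #<= f @` L.
  apply: (@set_inj_card_le _ _ _ _ f); last exact: inj.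
  by move=> x Lx; exists x.
have fLinf : infinite_set (f @` L).
  by apply/infiniteP/(card_le_trans _ LfL)/infiniteP.
have := Kmin (exist _ _ (conj fLinf (Pmono _ _ _ _ LfL PL))).
by move/card_le_trans; apply; exact: card_image_le.
Qed.

(** * Closure under an operation on sequences of countable sets *)

Section ContinuumClosure.
Variables (X : Type) (f : (nat -> set X) -> X).

(* The closure of the empty set under [f] is enumerated by well-founded
   countably branching trees, and such a tree is determined by the set of
   positions of its nodes; no recursion of length omega_1 is needed. *)
Inductive tree : Type := leaf | node of (nat -> nat -> tree).

Fixpoint tree_code (t : tree) : set nat :=
  if t is node g then
    [set 0%N] `|` [set n | exists i j m,
      tree_code (g i j) m /\ n = (pickle (i, j, m)).+1]
  else set0.

(** Membership of 0 separates nodes from leaves, and injectivity of [pickle] recovers the code of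
    every child. *)
Lemma tree_code_inj : injective tree_code.
Proof.
elim=> [|g IH] [|h] //= gh.
- have : (set0 : set nat) 0%N by rewrite gh; left.
  by [].
- have : (set0 : set nat) 0%N by rewrite -gh; left.
  by [].
congr node; apply/funext => i; apply/funext => j; apply: IH.
have ghP m : (tree_code (g i j) m <-> tree_code (h i j) m).
  move/seteqP: gh => [gh hg]; split=> [tm|tm].
    case: (gh (pickle (i, j, m)).+1) => [|//|]; first by right; exists i, j, m.
    move=> [i' [j' [m' [hm' [] /(pcan_inj pickleK)[-> -> ->]]]]].
    exact: hm'.
  case: (hg (pickle (i, j, m)).+1) => [|//|]; first by right; exists i, j, m.
  move=> [i' [j' [m' [hm' [] /(pcan_inj pickleK)[-> -> ->]]]]].
  exact: hm'.
by apply/seteqP; split=> m /ghP.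
Qed.

(** Row [i] of the children enumerates the [i]-th argument of [f]. A leaf has no value, so a row of
    leaves enumerates the empty set. *)
Fixpoint tree_eval (t : tree) : option X :=
  if t is node g then
    Some (f (fun i => [set x | exists j, tree_eval (g i j) = Some x]))
  else None.

Lemma continuum_closure : exists B : set X,
  [/\ B `<=` range f, B #<= [set: set nat] &
      forall s, (forall n, s n `<=` B /\ countable (s n)) -> B (f s)].
Proof.
pose B := [set x | exists t, tree_eval t = Some x].
exists B; split.
- by move=> x [[|g] //= [<-]]; eexists.
- rewrite -card_ge_some.
  apply: (@card_le_trans _ _ _ (range tree_eval)).
    by apply: subset_card_le => _ [x [t tx] <-]; exists t.
  apply: card_le_trans (card_image_le _ _) _.
  apply: (@set_inj_card_le _ _ _ _ tree_code) => //.
  by move=> t u _ _; exact: tree_code_inj.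
move=> s sB.
have /choice[g gP] : forall i, exists g : nat -> tree,
    s i = [set x | exists j, tree_eval (g j) = Some x].
  move=> i; have [siB] := sB i.
  case/pfcard_geP => [->|/surjfunPex[h sh]].
    by exists (fun=> leaf); apply/seteqP; split=> // x [].
  have /choice[g gh] : forall j, exists t, tree_eval t = Some (h j).
    by move=> j; apply: siB; rewrite sh; exists j.
  exists g; rewrite sh; apply/seteqP; split=> [_ [j _ <-]|x [j]].
    by exists j.
  by rewrite gh => -[<-]; exists j.
exists (node g) => /=; congr (Some (f _)).
by apply/funext => i; rewrite gP.
Qed.

End ContinuumClosure.

(** * Well-orders and transfinite recursion *)

Section WellOrder.
Variables (T : eqType) (le : rel T).
Hypothesis le_wo : well_order le.

Lemma well_order_min (A : set T) : A !=set0 ->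
  exists2 m, A m & forall x, A x -> le m x.
Proof.
move=> [x Ax]; have [|m [[Am mA] _]] := @le_wo (mem A).
  by exists x; apply/mem_set.
by exists m => [|y Ay]; [exact: set_mem|apply: mA; exact/mem_set].
Qed.

Lemma well_order_refl : reflexive le.
Proof.
by move=> x; have [|m ->] := @well_order_min [set x]; [exists x|apply].
Qed.

Lemma well_order_anti x y : le x y -> le y x -> x = y.
Proof.
move=> xy yx; have [|z [_ zU]] := @le_wo (mem [set x; y]).
  by exists x; apply/mem_set; left.
have xx := well_order_refl x; have yy := well_order_refl y.
have zE w : [set x; y] w -> le w x -> le w y -> z = w.
  by move=> /mem_set xyw wx wy; apply: zU; split=> // v /set_mem [->|->].
by rewrite -(zE x) ?(zE y)//; [right|left].
Qed.

Lemma well_order_trans : transitive le.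
Proof.
move=> y x z xy yz.
have [|m mP mle] := @well_order_min [set w | [\/ w = x, w = y | w = z]].
  by exists x; constructor 1.
have mx : le m x by apply: mle; constructor 1.
have my : le m y by apply: mle; constructor 2.
have mz : le m z by apply: mle; constructor 3.
case: mP => mE; rewrite mE in mx my mz => //.
  by rewrite (well_order_anti xy mx).
by rewrite -(well_order_anti yz my).
Qed.

Lemma well_order_wf : well_founded (fun x y => ~~ le y x).
Proof.
move=> x; apply: contrapT => nx.
have [|m nm mmin] := @well_order_min [set y | ~ Acc (fun x y => ~~ le y x) y].
  by exists x.
apply: nm; constructor => y /negP my; apply: contrapT => /mmin.
exact: my.
Qed.

(** Well-founded recursion with values in [Prop]: the condition on [a] sees only the members of [S]
    strictly below [a]. *)
Lemma well_order_rec_set (F : T -> set T -> Prop) :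
  exists S : set T, forall a, S a <-> F a (S `&` [set b | ~~ le a b]).
Proof.
pose G a (S : forall b, ~~ le a b -> Prop) := F a [set b | exists h, S b h].
exists (Fix well_order_wf (fun=> Prop) G) => a.
rewrite Fix_eq; last first.
  move=> {}a S S' SS'; rewrite /G; apply: propext.
  suff -> : S = S' by [].
  by apply/functional_extensionality_dep => b; apply/funext => h; exact: SS'.
rewrite /G; set S := Fix _ _ _.
suff -> : [set b | exists _ : ~~ le a b, S b] = S `&` [set b | ~~ le a b] by [].
by apply/seteqP; split=> b [].
Qed.

End WellOrder.

(** * Free sequences and countable covers *)

(* Run through [A] along a well-order and select the points lying in [U C] for
   every initial segment [C] of the set selected so far. The selected points
   form a free sequence, hence are countably many. *)
Lemma free_sequence_countable_cover (X : topologicalType) (A : set X)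
    (U : set X -> set X) :
  (forall (I : Type) (le : rel I) (x : I -> X),
     free_sequence le x -> countable (range x)) ->
  (forall C, C `<=` A -> closure (U C) `&` closure C = set0) ->
  exists s : nat -> set X, (forall n, s n `<=` A /\ countable (s n)) /\
    forall a, A a -> exists n, ~ U (s n) a.
Proof.
move=> free_countable UC.
have [le le_wo] := well_ordering_principle X.
pose below (S : set X) a := S `&` [set b | ~~ le a b].
have [S SP] := well_order_rec_set le_wo
  (fun a W => A a /\ forall c, le c a -> U (below W c) a).
(* For [c] at most [a], the segment below [c] is already decided at stage [a], so the recursion
   clause can be read with [S] itself. *)
have below2 a c : le c a -> below (below S a) c = below S c.
  move=> ca; apply/seteqP; split=> b [Sb cb].
    by split=> //; case: Sb.
  split=> //; split=> //; apply/negP => ab; move/negP: cb; apply.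
  exact: well_order_trans ab.
have SA : S `<=` A by move=> a /SP[].
have SU a c : S a -> le c a -> U (below S c) a.
  by move=> /SP[_ Sa] ca; rewrite -(below2 _ _ ca); exact: Sa.
have nSU a : A a -> ~ S a -> exists2 c, le c a & ~ U (below S c) a.
  move=> Aa nSa; apply: contrapT => noc; apply/nSa/SP; split=> // c ca.
  rewrite [below _ c](below2 _ _ ca); apply: contrapT => nU.
  by apply: noc; exists c.
have Scountable : countable S.
  pose I := {x : X | x \in S}.
  have : free_sequence (fun a b : I => le (val a) (val b)) val.
    split=> [D [x Dx]|a].
      have [|m [i Di im] mmin] :=
        @well_order_min _ _ le_wo [set val i | i in [set` D]].
        by exists (val x); exists x.
      exists i; split=> [|j [Dj jmin]].
        by split=> // j Dj; rewrite im; apply: mmin; exists j.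
      apply/val_inj/(well_order_anti le_wo); last exact: jmin.
      by rewrite im; apply: mmin; exists j.
    apply/seteqP; split=> // y [yl yr].
    (* The selected points from [a] on lie in [U] of the segment selected before [a], whose closure
       misses that of the segment. *)
    have : (closure (U (below S (val a))) `&` closure (below S (val a))) y.
      split; [move: yr|move: yl]; apply: closureS => _ [b ab <-].
        exact: SU (set_mem (valP b)) ab.
      by split; [exact: set_mem (valP b)|].
    by rewrite UC // => b [/SA].
  move/free_countable; apply: sub_countable; apply: subset_card_le => x Sx.
  by exists (exist _ x (mem_set Sx)).
(* For [a] in [S], [S] itself works. Otherwise some [c] excludes [a], and the segment below [c] is
   the one below the least [m] of [S] with [le c m], or all of [S] if there is no such [m]. *)
pose Q := [set S] `|` [set below S c | c in S].
have Qcountable : Q #<= [set: nat].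
  rewrite /Q -bigcup2E; apply: bigcup_countable => [|[|[|n]] _] //=.
    exact: sub_countable (card_image_le _ _) Scountable.
have QE a : A a -> exists C, Q C /\ ~ U C a.
  move=> Aa; have [Sa|nSa] := pselect (S a).
    exists S; split; first by left.
    move=> USa; suff : set0 a by [].
    by rewrite -(UC S SA); split; exact: subset_closure.
  have [c ca nU] := nSU a Aa nSa.
  have [ne|noS] := pselect ([set d | S d /\ le c d] !=set0); last first.
    exists S; split; first by left.
    suff <- : below S c = S by [].
    apply/seteqP; split=> [b []//|b Sb]; split=> //; apply/negP => cb.
    by apply: noS; exists b.
  have [m [Sm cm] mmin] := well_order_min le_wo ne.
  exists (below S m); split; first by right; exists m.
  suff -> : below S m = below S c by [].
  apply/seteqP; split=> b [Sb lb]; split=> //; apply/negP => le_b.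
    by move/negP: lb; apply; exact: mmin.
  by move/negP: lb; apply; exact: well_order_trans cm le_b.
have [Q0|/surjfunPex[s sE]] := pfcard_geP Qcountable.
  have : Q S by left.
  by rewrite Q0.
exists s; split=> [n|a /QE[C []]].
  have : Q (s n) by rewrite sE; exists n.
  have subS C : C `<=` S -> C `<=` A /\ countable C.
    move=> CS; split=> [x /CS/SA//|].
    exact: sub_countable (subset_card_le CS) _.
  by move=> [->|[c _ <-]]; apply: subS => // x [].
by rewrite sE => -[n _ <-]; exists n.
Qed.

(** * Tightness of the modified topology *)

Lemma tightness_Gdelta_modification_continuum (X : topologicalType)
    (A : set (Gdelta_modification X)) (p : Gdelta_modification X) :
  @regular_space X ->
  (forall (I : Type) (le : rel I) (x : I -> X),
     free_sequence le x -> countable (range x)) ->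
  closure A p ->
  exists B : set (Gdelta_modification X),
    [/\ B `<=` A, B #<= [set: set nat] & closure B p].
Proof.
move=> regX free_countable Ap.
have nbhs_Gdelta (G : set X) : Gdelta G -> G p ->
    nbhs (p : Gdelta_modification X) G.
  move=> dG Gp; rewrite nbhsE; exists G => //; split=> //.
  exists [set G]; first by move=> _ ->.
  by rewrite bigcup_set1.
have Gdelta_nbhs N : nbhs (p : Gdelta_modification X) N ->
    exists G : set X, [/\ Gdelta G, G p & G `<=` N].
  rewrite nbhsE => -[O [[D DG <-] [G DG' Gp]] ON].
  exists G; split=> //; first exact: DG.
  by move=> x Gx; apply: ON; exists G.
have /choice[U UP] : forall C : set X, exists V : set X, [/\ open V, V p &
    ~ closure C p -> closure V `&` closure C = set0].
  move=> C; have [Cp|nCp] := pselect (closure C p).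
    (* With [p] in the closure of [C] there is nothing to separate, and the whole space is the
       default. *)
    by exists setT; split=> //; exact: openT.
  have : nbhs (p : X) (~` closure C).
    by apply: open_nbhs_nbhs; split=> //; exact/closed_openC/closed_closure.
  case/regX => N pN NC.
  exists (interior N); split.
  - exact: open_interior.
  - exact: pN.
  - move=> _; apply/seteqP; split=> // x [xN xC].
    by apply: NC xC; apply: closureS xN; exact: interior_subset.
have /choice[f fP] : forall s : nat -> set X, exists x,
    A x /\ forall n, U (s n) x.
  move=> s; have [|x [Ax Ux]] := Ap (\bigcap_n U (s n)).
    apply: nbhs_Gdelta => [|n _]; last by have [] := UP (s n).
    by exists (fun n => U (s n)) => // n; have [] := UP (s n).
  by exists x; split=> // n; exact: Ux.
have [B [Bf Bcard Bclosed]] := continuum_closure f.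
exists B; split=> //.
  by move=> x /Bf[s _ <-]; have [] := fP s.
move=> N /Gdelta_nbhs[G [[F oF ->] Fp FN]].
have /choice[s sP] : forall i, exists s : nat -> set X,
    (forall n, s n `<=` B `\` F i /\ countable (s n)) /\
    forall a, (B `\` F i) a -> exists n, ~ U (s n) a.
  move=> i; apply: free_sequence_countable_cover => // C CBF.
  (* [F i] is a neighborhood of [p] disjoint from [C], so [p] is outside the closure of [C]. *)
  have [_ _] := UP C; apply => /(_ (F i))[].
    by apply: open_nbhs_nbhs; split; [exact: oF|exact: Fp].
  by move=> x [/CBF[_ +]].
(* The double sequence [s i j] is arranged in a single one; numbers coding no pair give the empty
   set. *)
pose t n := if unpickle n is Some (i, j) then s i j else set0.
have tB n : t n `<=` B /\ countable (t n).
  rewrite /t; case: unpickle => [[i j]|]; last by split; [|exact: countable0].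
  have [/(_ j)[sB sc] _] := sP i; split=> //.
  by move=> x /sB[].
exists (f t); split; first exact: Bclosed.
apply: FN => i _; apply: contrapT => nF.
have [_ /(_ (f t))[|j]] := sP i; first by split=> //; exact: Bclosed.
by apply; have [_ /(_ (pickle (i, j)))] := fP t; rewrite /t pickleK.
Qed.

Theorem corollary5 (X : topologicalType)
  (T1X : @accessible_space X) (regX : @regular_space X)
  (FX : free_sequence_number_is X [set: nat]) :
  exists (U : Type) (K : set U),
    tightness_is (Gdelta_modification X) K /\ K #<= [set: set nat].
Proof.
have [_ free_countable _] := FX.
(* Bounds for the tightness are upward closed and the continuum is one, so a least infinite bound
   exists and is at most the continuum. *)
exists (set nat); apply: least_infinite_cardinal_exists.
- move=> V V' L L' LL' PL A p /PL[B [BA BL Bp]].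
  by exists B; split=> //; exact: card_le_trans LL'.
- apply/infiniteP; apply: (@set_inj_card_le _ _ _ _ (@set1 nat)) => //.
  by move=> m n _ _ /seteqP[/(_ m erefl)].
- by move=> A p; exact: tightness_Gdelta_modification_continuum.
Qed.
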